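(* Let $R$ be a ring and $a\in R$. Then $a$ has Hirano inverse if and only if $a-a^3\in N(R)$.
   Context: All rings are associative with identity. $N(R)$ denotes the set of all nilpotent elements of $R$. An element $a\in R$ has Hirano inverse if there exists $b\in R$ such that $a^2-ab\in N(R)$, $ab=ba$ and $b=bab$. *)

(* Defs.v *)
From mathcomp Require Import all_boot all_algebra.
Set Implicit Arguments.
Unset Strict Implicit.
Unset Printing Implicit Defensive.
Import GRing.Theory.
Local Open Scope ring_scope.

(* The carrier is a [pzRingType]: associative and unital, not necessarily
   commutative, and the zero ring is allowed. *)

Definition nilpotent_elt (R : pzRingType) (x : R) : Prop :=
  exists n : nat, x ^+ n.+1 = 0.

Definition has_Hirano_inverse (R : pzRingType) (a : R) : Prop :=
  exists b : R,
    [/\ nilpotent_elt (a ^+ 2 - a * b), a * b = b * a & b = b * a * b].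

(* Main.v *)
Require Import Defs.
From mathcomp Require Import all_boot all_algebra.
Import GRing.Theory.
Local Open Scope ring_scope.

(** Write x = a^2.  Both conditions say that x is an idempotent up to a
    commuting nilpotent, because a (a - a^3) = x (1 - x), while the square of
    a - a^3 is x (1 - x)^2.

    If b is a Hirano inverse of a, then e = ab is idempotent and
    w = x - e is nilpotent and commutes with e.  Modulo w the element
    x (1 - x)^2 becomes e (1 - e)^2 = 0, so it is a multiple of w; thus a - a^3
    has a nilpotent square.

    Conversely, if x (1 - x) is nilpotent, then x is idempotent in the
    commutative ring Z[x] modulo a nilpotent ideal, so it lifts to an idempotent
    e = x s, with s a polynomial in x and
    x - e nilpotent ([nilpotent_lift_idempotent]).  Since x = a^2, the element
    b = a s e satisfies ab = x s e = e, whence bab = be = b, and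
    a^2 - ab = x - e is nilpotent. *)

Lemma nilpotent_mulr_comm {R : pzRingType} (w c : R) :
  GRing.comm w c -> nilpotent_elt w -> nilpotent_elt (w * c).
Proof.
by move=> wc [n wn0]; exists n; rewrite (exprMn_comm _ wc) wn0 mul0r.
Qed.

Lemma nilpotent_of_sqr {R : pzRingType} (x : R) :
  nilpotent_elt (x ^+ 2) -> nilpotent_elt x.
Proof.
by case=> n; rewrite -exprM => xn0; exists (2 * n).+1; rewrite -xn0 mulnS.
Qed.

Lemma onem_exprE {R : pzRingType} (y : R) n :
  1 - y ^+ n = (1 - y) * \sum_(i < n) y ^+ i.
Proof. by rewrite -[LHS]opprB subrX1 -mulNr opprB. Qed.

Lemma commr_sum_expr {R : pzRingType} (z y : R) n :
  GRing.comm z y -> GRing.comm z (\sum_(i < n) y ^+ i).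
Proof. by move=> zy; apply: commr_sum => i _; exact: commrX. Qed.

(** With y = 1 - x and (x y)^m = 0, the idempotent is e = (1 - y^m)^m: it is
    divisible by x^m, because 1 - y^m is divisible by 1 - y = x, and 1 - e is
    divisible by y^m, so e (1 - e) = 0.  Moreover x - e = x (1 - e) - e (1 - x)
    is a multiple of x y.  The commutation clause is the form in which the fact
    that s is a polynomial in x gets used. *)
Lemma nilpotent_lift_idempotent {R : pzRingType} (x : R) :
  nilpotent_elt (x * (1 - x)) ->
  exists s : R, [/\ forall z, GRing.comm z x -> GRing.comm z s,
    x * s * (x * s) = x * s & nilpotent_elt (x - x * s)].
Proof.
case=> n; set y := 1 - x; set m := n.+1 => xym0.
have commy z : GRing.comm z x -> GRing.comm z y.
  by move=> zx; apply: commrB => //; exact: commr1.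
pose q := \sum_(i < m) y ^+ i.
have commq z : GRing.comm z x -> GRing.comm z q.
  by move=> zx; apply/commr_sum_expr/commy.
have xqE : x * q = 1 - y ^+ m by rewrite onem_exprE /y subKr.
pose s := q * (x * q) ^+ n.
have comms z : GRing.comm z x -> GRing.comm z s.
  move=> zx; apply: commrM; first exact: commq.
  by apply: commrX; apply: commrM => //; exact: commq.
have eE : x * s = (x * q) ^+ m by rewrite /s mulrA -exprS.
have xy : GRing.comm x y by exact: commy.
have xq : GRing.comm x q by exact: commq.
have xs : GRing.comm x s by exact: comms.
have ys : GRing.comm y s by apply: comms; exact/commr_sym.
pose r := \sum_(i < m) (x * q) ^+ i.
have f_eq : 1 - x * s = y ^+ m * r by rewrite eE onem_exprE {1}xqE subKr.
have qy : GRing.comm q y by apply/commy/commr_sym.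
have e_f0 : x * s * (1 - x * s) = 0.
  rewrite f_eq eE (exprMn_comm _ xq) mulrA -(mulrA (x ^+ m)).
  rewrite (commrX m (commr_sym (commrX m (commr_sym qy)))) mulrA.
  by rewrite -(exprMn_comm _ xy) xym0 !mul0r.
exists s; split=> //.
  by move: e_f0; rewrite mulrBr mulr1 => /subr0_eq <-.
have commxy z : GRing.comm z x -> GRing.comm z (x * y).
  by move=> zx; apply: commrM => //; exact: commy.
have comm_r z : GRing.comm z x -> GRing.comm z r.
  by move=> zx; apply/commr_sum_expr/commrM => //; exact: commq.
have -> : x - x * s = x * y * (y ^+ n * r - s).
  have -> : x - x * s = x * (1 - x * s) - x * s * y.
    rewrite [in x * s * y]/y !mulrBr !mulr1.
    by rewrite -[x * s * x](commrM (commr_refl x) xs) opprB addrA subrK.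
  by rewrite f_eq exprS (mulrBr (x * y)) -(mulrA x s y) -ys !mulrA.
apply: nilpotent_mulr_comm; last by exists n.
apply: commrB; last by apply/commr_sym/commxy/commr_sym.
apply: commrM; last by apply/comm_r/commr_sym/commxy.
by apply/commrX/commy/commr_sym/commxy.
Qed.

Lemma Hirano_inverse_nilpotent {R : pzRingType} (a : R) :
  has_Hirano_inverse a -> nilpotent_elt (a - a ^+ 3).
Proof.
case=> b [w_nil ab bab]; apply: nilpotent_of_sqr.
set e := a * b in w_nil; set w := a ^+ 2 - e in w_nil.
have ee : e * e = e by rewrite /e -mulrA (mulrA b) -bab.
have ae : GRing.comm a e by apply: commrM.
have aa : GRing.comm a (a ^+ 2) by exact: commrX.
have x_e : GRing.comm (a ^+ 2) e by apply/commr_sym/commrX/commr_sym.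
have xw : GRing.comm (a ^+ 2) w by apply: commrB.
have ew : GRing.comm e w by apply: commrB => //; exact: commr_sym.
have xE : a ^+ 2 = w + e by rewrite subrK.
set u := 1 - a ^+ 2.
have wu : GRing.comm w u.
  by apply: commrB; [exact: commr1 | exact: commr_sym].
(* As u is 1 - e - w and e (1 - e) = 0, the part of u along e is nilpotent. *)
have eu : e * u = - (w * e).
  by rewrite /u xE mulrBr mulr1 mulrDr ee -ew addrC opprD addrNK.
have -> : (a - a ^+ 3) ^+ 2 = w * ((u - e) * u).
  have -> : a - a ^+ 3 = a * u by rewrite mulrBr mulr1 -exprS.
  rewrite exprMn_comm; last by apply: commrB => //; exact: commr1.
  rewrite {1}xE mulrDl expr2 [e * _]mulrA eu mulNr.
  by rewrite (mulrBl u u e) (mulrBr w) !mulrA.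
apply: nilpotent_mulr_comm => //.
by apply: commrM => //; apply: commrB => //; exact: commr_sym.
Qed.

Lemma nilpotent_Hirano_inverse {R : pzRingType} (a : R) :
  nilpotent_elt (a - a ^+ 3) -> has_Hirano_inverse a.
Proof.
move=> a_nil.
have aX n : GRing.comm a (a ^+ n) by exact: commrX.
have /nilpotent_lift_idempotent[s [comms ee w_nil]] :
    nilpotent_elt (a ^+ 2 * (1 - a ^+ 2)).
  have -> : a ^+ 2 * (1 - a ^+ 2) = (a - a ^+ 3) * a.
    by rewrite mulrBr mulr1 mulrBl -exprD -expr2 -exprSr.
  apply: nilpotent_mulr_comm => //.
  by apply/commr_sym/commrB.
have as_ : GRing.comm a s by apply: comms.
set e := a ^+ 2 * s in ee w_nil.
have ae : GRing.comm a e by apply: commrM.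
have ab : a * (a * s * e) = e by rewrite (mulrA a (a * s)) (mulrA a a s) -expr2.
have a_b : GRing.comm a (a * s * e) by do 2![apply: commrM => //].
(* The factor e, harmless in ab because e is idempotent, gives b = b e = bab. *)
exists (a * s * e); rewrite -a_b ab; split=> //.
have eb : GRing.comm e (a * s * e).
  apply: commrM => //; apply: commrM; first exact: commr_sym.
  by apply/comms/commrX/commr_sym.
by rewrite eb -(mulrA (a * s)) ee.
Qed.

Theorem theorem3p1 (R : pzRingType) (a : R) :
  has_Hirano_inverse a <-> nilpotent_elt (a - a ^+ 3).
Proof.
by split; [exact: Hirano_inverse_nilpotent | exact: nilpotent_Hirano_inverse].
Qed.
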